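(* Let $\mathcal{Z}_q$, $\mathcal{Z}_q^{\circ}$ and $\mathcal{Z}_q^{\circ}[1]$ be the $\mathbb{Q}$-vector spaces of formal $q$-series defined in the context. Then the following equalities hold: \begin{enumerate} \item[(i)] $\mathcal{Z}_q = \Big\langle \begin{bmatrix} s_1,\dots,s_l\\ r_1,\dots,r_l\end{bmatrix} \;\Big|\; l\ge 0,\ s_1,\dots,s_l\ge 1,\ r_1,\dots,r_l\ge 0\Big\rangle_{\mathbb{Q}}$; \item[(ii)] $\mathcal{Z}_q^{\circ} = \big\langle [s_1,\dots,s_l] \;\big|\; l\ge 0,\ s_1,\dots,s_l\ge 1\big\rangle_{\mathbb{Q}}$; \item[(iii)] $\mathcal{Z}_q^{\circ}[1] = \big\langle [s_1,\dots,s_l] \;\big|\; l\ge 0,\ s_1,\dots,s_l\ge 2\big\rangle_{\mathbb{Q}}$. \end{enumerate}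
   Context: All series are formal power series in $\mathbb{Q}[[q]]$. For integers $s_1,\dots,s_l\ge 1$ and polynomials $Q_1\in t\mathbb{Q}[t]$, $Q_2,\dots,Q_l\in\mathbb{Q}[t]$ set $$\zeta_q(s_1,\dots,s_l;Q_1,\dots,Q_l)=\sum_{n_1>\cdots>n_l>0}\frac{Q_1(q^{n_1})\cdots Q_l(q^{n_l})}{(1-q^{n_1})^{s_1}\cdots(1-q^{n_l})^{s_l}},$$ with the convention that this equals $1$ when $l=0$. Define $\mathcal{Z}_q$ as the $\mathbb{Q}$-span of all $\zeta_q(s_1,\dots,s_l;Q_1,\dots,Q_l)$ with $l\ge0$, $s_j\ge1$, $Q_1\in t\mathbb{Q}[t]$, $Q_2,\dots,Q_l\in\mathbb{Q}[t]$ and $\deg Q_j\le s_j$ for all $j$. Let $\mathcal{Z}_q^{\circ}\subseteq\mathcal{Z}_q$ be the span of those generators in which all $Q_1,\dots,Q_l\in t\mathbb{Q}[t]$, and let $\mathcal{Z}_q^{\circ}[1]$ be the span of those generators with all $Q_j\in t\mathbb{Q}[t]$ and $\deg Q_j\le s_j-1$ for all $j$. For $s_1,\dots,s_l\ge1$, $r_1,\dots,r_l\ge0$ the bi-bracket is $$\begin{bmatrix} s_1,\dots,s_l\\ r_1,\dots,r_l\end{bmatrix}=\sum_{\substack{u_1>\cdots>u_l>0\\ v_1,\dots,v_l>0}}\frac{u_1^{r_1}\cdots u_l^{r_l}}{r_1!\cdots r_l!}\cdot\frac{v_1^{s_1-1}\cdots v_l^{s_l-1}}{(s_1-1)!\cdots(s_l-1)!}\,q^{u_1v_1+\cdots+u_lv_l}\in\mathbb{Q}[[q]],$$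 (equal to $1$ for $l=0$), and the bracket is $[s_1,\dots,s_l]=\begin{bmatrix} s_1,\dots,s_l\\ 0,\dots,0\end{bmatrix}$. *)

(* Defs.v *)
From HB Require Import structures.
From mathcomp Require Import all_boot all_order all_algebra.
From mathcomp Require Import boolp classical_sets functions cardinality fsbigop.

Set Implicit Arguments.
Unset Strict Implicit.
Unset Printing Implicit Defensive.

Import Order.TTheory GRing.Theory Num.Theory.
Local Open Scope classical_set_scope.
Local Open Scope ring_scope.

(* A record, rather than [nat -> rat] itself, so that the Cauchy product below
   cannot be confused with the pointwise product of functions. *)
Record fps := Fps { fcoef : nat -> rat }.

HB.instance Definition _ := gen_eqMixin fps.
HB.instance Definition _ := gen_choiceMixin fps.

Lemma fpsP (f g : fps) : fcoef f =1 fcoef g <-> f = g.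
Proof. by split=> [|-> //]; case: f g => f [g] /= /funext ->. Qed.

Definition fps_zero := Fps (fun=> 0).
Definition fps_one := Fps (fun N => (N == 0%N)%:R).
Definition fps_opp (f : fps) := Fps (fun N => - fcoef f N).
Definition fps_add (f g : fps) := Fps (fun N => fcoef f N + fcoef g N).
Definition fps_mul (f g : fps) :=
  Fps (fun N => \sum_(i < N.+1) fcoef f i * fcoef g (N - i)%N).
Definition fps_scale (c : rat) (f : fps) := Fps (fun N => c * fcoef f N).

Fact fps_addA : associative fps_add.
Proof. by move=> f g h; apply/fpsP => N /=; rewrite addrA. Qed.
Fact fps_addC : commutative fps_add.
Proof. by move=> f g; apply/fpsP => N /=; rewrite addrC. Qed.
Fact fps_add0 : left_id fps_zero fps_add.
Proof. by move=> f; apply/fpsP => N /=; rewrite add0r. Qed.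
Fact fps_addN : left_inverse fps_zero fps_opp fps_add.
Proof. by move=> f; apply/fpsP => N /=; rewrite addNr. Qed.

HB.instance Definition _ :=
  GRing.isZmodule.Build fps fps_addA fps_addC fps_add0 fps_addN.

Lemma fcoef0 N : fcoef 0 N = 0. Proof. by []. Qed.
Lemma fcoefD f g N : fcoef (f + g) N = fcoef f N + fcoef g N. Proof. by []. Qed.
Lemma fcoefN f N : fcoef (- f) N = - fcoef f N. Proof. by []. Qed.

Definition fps_trunc N (f : fps) : {poly rat} := \poly_(i < N.+1) fcoef f i.

Lemma coef_fps_trunc N f i : (i <= N)%N -> (fps_trunc N f)`_i = fcoef f i.
Proof. by move=> iN; rewrite coef_poly ltnS iN. Qed.

Lemma fps_mul_trunc N f g i : (i <= N)%N ->
  fcoef (fps_mul f g) i = (fps_trunc N f * fps_trunc N g)`_i.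
Proof.
move=> iN; rewrite coefM /=; apply: eq_bigr => j _.
rewrite !coef_fps_trunc //; first by rewrite (leq_trans _ iN) ?leq_subr.
by rewrite (leq_trans _ iN) // -ltnS.
Qed.

Fact fps_mulA : associative fps_mul.
Proof.
move=> f g h; apply/fpsP => N.
have Hl : fcoef (fps_mul f (fps_mul g h)) N =
    (fps_trunc N f * (fps_trunc N g * fps_trunc N h))`_N.
  rewrite [RHS]coefM /=; apply: eq_bigr => j _.
  by rewrite -fps_mul_trunc ?leq_subr // coef_fps_trunc // -ltnS.
have Hr : fcoef (fps_mul (fps_mul f g) h) N =
    ((fps_trunc N f * fps_trunc N g) * fps_trunc N h)`_N.
  rewrite [RHS]coefM /=; apply: eq_bigr => j _.
  have jN : (j <= N)%N by rewrite -ltnS.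
  by rewrite -fps_mul_trunc // coef_fps_trunc // leq_subr.
by rewrite Hl Hr mulrA.
Qed.

Fact fps_mulC : commutative fps_mul.
Proof.
by move=> f g; apply/fpsP => N; rewrite !(fps_mul_trunc _ _ (leqnn N)) mulrC.
Qed.

Fact fps_mul1 : left_id fps_one fps_mul.
Proof.
move=> f; apply/fpsP => N /=; rewrite big_ord_recl /= mul1r subn0.
by rewrite big1 ?addr0 // => i _; rewrite mul0r.
Qed.

Fact fps_mulDl : left_distributive fps_mul fps_add.
Proof.
move=> f g h; apply/fpsP => N /=; rewrite -big_split /=.
by apply: eq_bigr => i _; rewrite mulrDl.
Qed.

Fact fps_one_neq0 : fps_one != 0.
Proof. by apply/eqP => /fpsP /(_ 0%N) /eqP; rewrite /= oner_eq0. Qed.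

HB.instance Definition _ := GRing.Zmodule_isComNzRing.Build fps
  fps_mulA fps_mulC fps_mul1 fps_mulDl fps_one_neq0.

Lemma fcoef1 N : fcoef 1 N = (N == 0%N)%:R. Proof. by []. Qed.
Lemma fcoefM f g N :
  fcoef (f * g) N = \sum_(i < N.+1) fcoef f i * fcoef g (N - i)%N.
Proof. by []. Qed.

Fact fps_scaleA a b f : fps_scale a (fps_scale b f) = fps_scale (a * b) f.
Proof. by apply/fpsP => N /=; rewrite mulrA. Qed.
Fact fps_scale1 : left_id 1 fps_scale.
Proof. by move=> f; apply/fpsP => N /=; rewrite mul1r. Qed.
Fact fps_scaleDr : right_distributive fps_scale +%R.
Proof. by move=> a f g; apply/fpsP => N /=; rewrite mulrDr. Qed.
Fact fps_scaleDl f : {morph fps_scale^~ f : a b / a + b}.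
Proof. by move=> a b; apply/fpsP => N /=; rewrite mulrDl. Qed.

HB.instance Definition _ := GRing.Zmodule_isLmodule.Build rat fps
  fps_scaleA fps_scale1 fps_scaleDr fps_scaleDl.

Lemma fcoefZ c f N : fcoef (c *: f) N = c * fcoef f N. Proof. by []. Qed.

Fact fps_scaleAl (a : rat) (f g : fps) : a *: (f * g) = (a *: f) * g.
Proof.
apply/fpsP => N; rewrite fcoefZ !fcoefM mulr_sumr.
by apply: eq_bigr => i _; rewrite fcoefZ mulrA.
Qed.

HB.instance Definition _ := GRing.Lmodule_isLalgebra.Build rat fps fps_scaleAl.
HB.instance Definition _ := GRing.Lalgebra_isComAlgebra.Build rat fps.

(* The inverse is chosen classically (it is unique when it exists), so that
   [f / g] is the quotient in Q[[q]] whenever [g] is invertible there;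
   [fps_unit_1subq] below provides the invertibility of [1 - q ^ n]. *)
Definition fps_unit : pred fps := fun f => `[< exists g, g * f = 1 >].
Definition fps_inv (f : fps) : fps :=
  if pselect (exists g, g * f = 1) is left ex then projT1 (cid ex) else f.

Fact fps_mulV : {in fps_unit, left_inverse 1 fps_inv *%R}.
Proof.
move=> f /asboolP ex; rewrite /fps_inv.
by case: pselect => [ex'|//]; case: cid.
Qed.
Fact fps_unitP (f g : fps) : g * f = 1 -> fps_unit f.
Proof. by move=> gf; apply/asboolP; exists g. Qed.
Fact fps_inv_out : {in [predC fps_unit], fps_inv =1 id}.
Proof.
move=> f; rewrite inE /= => nf; rewrite /fps_inv.
by case: pselect => // ex; case/asboolP: nf.
Qed.

HB.instance Definition _ := GRing.ComNzRing_hasMulInverse.Build fps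
  fps_mulV fps_unitP fps_inv_out.

Definition fps_q : fps := Fps (fun N => (N == 1%N)%:R).

Lemma fcoef_qn n N : fcoef (fps_q ^+ n) N = (N == n)%:R.
Proof.
elim: n N => [|n IHn] N; first by rewrite expr0 fcoef1.
rewrite exprS fcoefM; case: N => [|N].
  by rewrite big_ord_recl big_ord0 /= mul0r addr0.
rewrite 2!big_ord_recl /= mul0r add0r mul1r IHn subn1 /= eqSS.
by rewrite big1 ?addr0 // => i _; rewrite mul0r.
Qed.

Lemma fcoef_qnM n f N :
  fcoef (fps_q ^+ n * f) N = if (n <= N)%N then fcoef f (N - n)%N else 0.
Proof.
rewrite fcoefM; case: leqP => nN; last first.
  rewrite big1 // => i _; rewrite fcoef_qn.
  by rewrite (ltn_eqF (leq_trans (ltn_ord i) nN)) mul0r.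
rewrite (bigD1 (Ordinal (nN : (n < N.+1)%N))) //= fcoef_qn eqxx mul1r.
rewrite big1 ?addr0 // => i /eqP ni; rewrite fcoef_qn.
by case: eqP => [in_|]; rewrite ?mul0r //; case: ni; apply/val_inj.
Qed.

Lemma fps_unit_1subq n : (0 < n)%N -> 1 - fps_q ^+ n \is a GRing.unit.
Proof.
move=> n_gt0; pose g := Fps (fun N => (n %| N)%:R).
apply/unitrP; exists g; rewrite mulrC; suff -> : (1 - fps_q ^+ n) * g = 1 by [].
apply/fpsP => N; rewrite mulrBl mul1r fcoefD fcoefN fcoef_qnM fcoef1 /=.
case: leqP => nN.
  rewrite -{1}(subnK nN) dvdn_addl // subrr.
  by rewrite (gtn_eqF (leq_trans n_gt0 nN)).
rewrite subr0; case: N nN => [|N] nN; first by rewrite dvdn0.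
by rewrite gtnNdvd.
Qed.

(* The sum of the family [F i], [i] in [A], computed coefficientwise;
   [\sum_(i \in A)] is the sum over the finitely many indices contributing
   a nonzero term, so it is meaningful when the family is [fps_summable]. *)
Definition fps_sum (I : choiceType) (A : set I) (F : I -> fps) : fps :=
  Fps (fun N => \sum_(i \in A) fcoef (F i) N).

Definition fps_summable (I : choiceType) (A : set I) (F : I -> fps) : Prop :=
  forall N, finite_set (A `&` [set i | fcoef (F i) N != 0]).

Definition lin_span (V : lmodType rat) (S : set V) : set V :=
  [set f | exists (k : nat) (c : 'I_k -> rat) (g : 'I_k -> V),
     (forall i, S (g i)) /\ f = \sum_(i < k) c i *: g i].

(* Here and below the indices 1, ..., l are the elements 0, ..., l-1 of ['I_l]. *)
Definition dec_pos (l : nat) : set {ffun 'I_l -> nat} :=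
  [set n | (forall i j : 'I_l, (i < j)%N -> (n j < n i)%N) /\
           (forall i, (0 < n i)%N)].

Definition all_pos (l : nat) : set {ffun 'I_l -> nat} :=
  [set v | forall i, (0 < v i)%N].

Definition qzeta_term (l : nat) (s : 'I_l -> nat) (Q : 'I_l -> {poly rat})
    (n : {ffun 'I_l -> nat}) : fps :=
  \prod_(j < l) (horner_alg (fps_q ^+ n j) (Q j) / (1 - fps_q ^+ n j) ^+ s j).

Definition qzeta (l : nat) (s : 'I_l -> nat) (Q : 'I_l -> {poly rat}) : fps :=
  fps_sum (@dec_pos l) (qzeta_term s Q).

Definition tQt : set {poly rat} := [set P | 'X %| P].

(* As [size P] is [deg P + 1], and [0] for [P = 0], the condition [deg P <= d]
   is [size P <= d + 1]. *)
Definition Zq : set fps := lin_span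
  [set f | exists (l : nat) (s : 'I_l -> nat) (Q : 'I_l -> {poly rat}),
     [/\ forall j, (1 <= s j)%N,
         forall j : 'I_l, j = 0%N :> nat -> tQt (Q j),
         forall j, (size (Q j) <= (s j).+1)%N
       & f = qzeta s Q]].

Definition Zq_circ : set fps := lin_span
  [set f | exists (l : nat) (s : 'I_l -> nat) (Q : 'I_l -> {poly rat}),
     [/\ forall j, (1 <= s j)%N,
         forall j, tQt (Q j),
         forall j, (size (Q j) <= (s j).+1)%N
       & f = qzeta s Q]].

Definition Zq_circ1 : set fps := lin_span
  [set f | exists (l : nat) (s : 'I_l -> nat) (Q : 'I_l -> {poly rat}),
     [/\ forall j, (1 <= s j)%N,
         forall j, tQt (Q j),
         forall j, (size (Q j) <= (s j).-1.+1)%N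
       & f = qzeta s Q]].

Definition bibracket_term (l : nat) (s r : 'I_l -> nat)
    (uv : {ffun 'I_l -> nat} * {ffun 'I_l -> nat}) : fps :=
  let: (u, v) := uv in
  ((\prod_(j < l) ((u j)%:R ^+ r j / (r j)`!%:R)) *
   (\prod_(j < l) ((v j)%:R ^+ (s j).-1 / ((s j).-1)`!%:R))) *:
  fps_q ^+ (\sum_(j < l) u j * v j)%N.

Definition bibracket (l : nat) (s r : 'I_l -> nat) : fps :=
  fps_sum (@dec_pos l `*` @all_pos l) (bibracket_term s r).

Definition bracket (l : nat) (s : 'I_l -> nat) : fps := bibracket s (fun=> 0%N).

Lemma finite_bounded_ffun (l N : nat) (A : set {ffun 'I_l -> nat}) :
  (forall n, A n -> forall j, (n j <= N)%N) -> finite_set A.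
Proof.
move=> AN; pose g (m : {ffun 'I_l -> 'I_N.+1}) : {ffun 'I_l -> nat} :=
  [ffun j => val (m j)].
apply: (@sub_finite_set _ _ (g @` setT)); last exact/finite_image/finite_finset.
move=> n /AN nN; exists [ffun j => inord (n j)] => //.
by apply/ffunP => j; rewrite !ffunE /= inordK // ltnS.
Qed.

Lemma qzeta_summable (l : nat) (s : 'I_l -> nat) (Q : 'I_l -> {poly rat}) :
  (forall j : 'I_l, j = 0%N :> nat -> tQt (Q j)) ->
  fps_summable (@dec_pos l) (qzeta_term s Q).
Proof.
case: l s Q => [|l] s Q Q0 N.
  by apply: (@finite_bounded_ffun 0 0) => n _ [].
apply: (@finite_bounded_ffun _ N) => n [[ndec _] /= nN] j.
have nj : (n j <= n ord0)%N.
  case: (posnP j) => [j0|j_gt0]; last exact/ltnW/ndec.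
  by rewrite (_ : j = ord0) //; apply: val_inj.
apply: leq_trans nj _; rewrite leqNgt; apply: contra nN => nN; apply/eqP.
rewrite /qzeta_term big_ord_recl; have /dvdpP[P ->] := Q0 ord0 erefl.
have -> x : horner_alg x (P * 'X) = horner_alg x P * x :> fps.
  by rewrite rmorphM /= horner_algX.
by rewrite -!mulrA mulrCA fcoef_qnM leqNgt nN.
Qed.

Lemma bibracket_summable (l : nat) (s r : 'I_l -> nat) :
  fps_summable (@dec_pos l `*` @all_pos l) (bibracket_term s r).
Proof.
move=> N; pose B := [set n : {ffun 'I_l -> nat} | forall j, (n j <= N)%N].
have fB : finite_set B by apply: (@finite_bounded_ffun _ N).
apply: (sub_finite_set _ (finite_setX fB fB)) => -[u v] [[[_ u0] v0]].
rewrite {1}/mkset /bibracket_term fcoefZ fcoef_qn.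
case: (N =P _) => [NE _|_]; last by rewrite mulr0 eqxx.
have uvN j : (u j * v j <= N)%N.
  by rewrite NE (bigD1 j) //= leq_addr.
by split=> j /=; apply: leq_trans (uvN j); rewrite ?leq_pmulr ?leq_pmull.
Qed.

(* Main.v *)
(* Up to linear combinations, every series here is a nested sum over
   n_1 > ... > n_l > 0 of products f_1(n_1) ... f_l(n_l) of letters, and nested
   sums are multilinear in their letters, so only the spans of the letters
   matter.  With x = q^n, both Q(x) / (1 - x)^s for Q in tQ[t] of degree <= s
   and the sum over v > 0 of P(v) x^v for P in Q[v] span the same space as the
   poles x / (1 - x)^(j+1), j >= 0; the conditions deg Q <= s - 1 and P(0) = 0
   both correspond to j >= 1.  This gives (ii) and (iii).
   For (i), lifting the restriction Q(0) = 0 adds the letter 1 to all positions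
   but the first.  Summing out the letters 1 multiplies the poles by
   polynomials in n_1, ..., n_l, which are the additional weights of
   bi-brackets; conversely summation by parts absorbs such polynomials into
   letters 1. *)
Require Import Defs.
From mathcomp Require Import all_boot all_order all_algebra.
From mathcomp Require Import boolp classical_sets functions fsbigop.

Set Implicit Arguments.
Unset Strict Implicit.
Unset Printing Implicit Defensive.

Import Order.TTheory GRing.Theory Num.Theory.
Local Open Scope classical_set_scope.
Local Open Scope ring_scope.

(** * Linear spans over the rationals *)

Section LinSpan.
Variable V : lmodType rat.
Implicit Type S : set V.

Lemma mem_lin_span S f : S f -> lin_span S f.
Proof.
move=> Sf; exists 1%N, (fun=> 1), (fun=> f); split=> //.
by rewrite big_ord1 scale1r.
Qed.

Lemma lin_span0 S : lin_span S 0.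
Proof.
by exists 0%N, (fun=> 0), (fun=> 0); split=> [[]|] //; rewrite big_ord0.
Qed.

Lemma lin_spanD S f g : lin_span S f -> lin_span S g -> lin_span S (f + g).
Proof.
move=> [k [c [u [Su ->]]]] [k' [c' [u' [Su' ->]]]].
pose pick T (a : 'I_k -> T) (b : 'I_k' -> T) (i : 'I_(k + k')) :=
  match fintype.split i with inl j => a j | inr j => b j end.
exists (k + k')%N, (pick _ c c'), (pick _ u u'); split=> [i|].
  by rewrite /pick; case: fintype.split.
rewrite big_split_ord /=; congr (_ + _); apply: eq_bigr => i _; rewrite /pick.
  by rewrite (unsplitK (inl i : 'I_k + 'I_k')).
by rewrite (unsplitK (inr i : 'I_k + 'I_k')).
Qed.

Lemma lin_spanZ S c f : lin_span S f -> lin_span S (c *: f).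
Proof.
move=> [k [a [u [Su ->]]]]; exists k, (fun i => c * a i), u; split=> //.
by rewrite scaler_sumr; apply: eq_bigr => i _; rewrite scalerA.
Qed.

End LinSpan.

(** The induction principle for spans used throughout: a claim about a linear operation on a span is
    checked on generators. Linearity is a plain hypothesis, so that operations such as [cons_sum f]
    or [poly_mul^~ F] can be used directly. *)
Lemma lin_span_linear (V W : lmodType rat) (S : set V) (S' : set W)
    (h : V -> W) : linear h ->
  (forall f, S f -> lin_span S' (h f)) ->
  forall f, lin_span S f -> lin_span S' (h f).
Proof.
move=> hlin hS _ [k [c [u [Su ->]]]].
have h0 : h 0 = 0.
  by have /eqP := hlin 1 0 0; rewrite !scale1r addr0 -subr_eq0 opprD addrA
    subrr sub0r oppr_eq0 => /eqP.
apply: (big_ind (fun f => lin_span S' (h f))) => [|f g Sf Sg|i _].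
- by rewrite h0; apply: lin_span0.
- by rewrite -[f]scale1r hlin; apply/lin_spanD/Sg/lin_spanZ.
- by rewrite -[_ *: _]addr0 hlin h0 addr0; apply/lin_spanZ/hS.
Qed.

Lemma lin_span_sub (V : lmodType rat) (S S' : set V) :
  S `<=` lin_span S' -> lin_span S `<=` lin_span S'.
Proof. by move=> SS' f; apply: (@lin_span_linear _ _ _ _ id) => //. Qed.

Lemma lin_span_eq (V : lmodType rat) (S S' : set V) :
  S `<=` lin_span S' -> S' `<=` lin_span S -> lin_span S = lin_span S'.
Proof. by move=> ? ?; apply/seteqP; split; apply: lin_span_sub. Qed.

(** * Nested sums of words and their multilinearity *)

(* A letter [f : nat -> fps] has [f i] for its value at [n = i + 1]; a word in
   letters [f_1 ... f_l] is evaluated to the function sending [M] to the sum of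
   [f_1(n_1) ... f_l(n_l)] over [M >= n_1 > ... > n_l > 0]. *)
Notation letter := (nat -> fps).

Definition cons_sum (f F : letter) : letter := fun M => \sum_(i < M) f i * F i.

Inductive word_sums (G : set letter) : set letter :=
| word_sums_nil : word_sums G (fun=> 1)
| word_sums_cons f F : G f -> word_sums G F -> word_sums G (cons_sum f F).

(** The first letter has its own set because only Q_1 is required to be divisible by t. *)
Definition headed_sums (H G : set letter) : set letter :=
  [set F | F = (fun=> 1) \/
           exists f F', [/\ H f, word_sums G F' & F = cons_sum f F']].

(** The same nested sums with the letters given as a family, as in [qzeta] and [bibracket]; the
    inductive [word_sums] serves for inductions on words. *)
Fixpoint word_sum (l : nat) : ('I_l -> letter) -> letter :=
  match l with
  | 0 => fun _ _ => 1
  | l'.+1 => fun f => cons_sum (f ord0) (word_sum (fun j => f (lift ord0 j)))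
  end.

(* If [f_1(n)] is a multiple of [q ^ n], letting [M] tend to infinity does not
   affect the coefficients of [q ^ N] from [M = N] on. *)
Definition sum_lim (F : letter) : fps := Fps (fun N => fcoef (F N) N).

Lemma headed_sums_diag (G : set letter) : headed_sums G G = word_sums G.
Proof.
apply/seteqP; split=> F.
  by case=> [->|[f [F' [? ? ->]]]]; constructor.
by case=> [|f F' Gf GF']; [left|right; exists f, F'].
Qed.

Lemma word_sumsP (G : set letter) F : word_sums G F <->
  exists l (f : 'I_l -> letter), (forall j, G (f j)) /\ F = word_sum f.
Proof.
split; last first.
  move=> [l [f [Gf ->]]]; elim: l f Gf => [|l IHl] f Gf /=; constructor=> //.
  exact: IHl.
elim=> [|f F' Gf _ [l [g [Gg ->]]]].
  by exists 0%N, (fun=> 0); split=> [[]|].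
exists l.+1, (fun j => if unlift ord0 j is Some j' then g j' else f).
split=> [j|/=]; first by case: unliftP.
rewrite unlift_none; congr cons_sum; congr word_sum.
by apply/funext => j; rewrite liftK.
Qed.

Lemma headed_sumsP (H G : set letter) F : headed_sums H G F <->
  exists l (f : 'I_l -> letter),
    (forall j : 'I_l, if j == 0%N :> nat then H (f j) else G (f j)) /\
    F = word_sum f.
Proof.
split=> [[->|[f [F' [Hf /word_sumsP[l [g [Gg ->]]] ->]]]]|].
- by exists 0%N, (fun=> 0); split=> [[]|].
- exists l.+1, (fun j => if unlift ord0 j is Some j' then g j' else f).
  split=> [j|/=]; first by case: unliftP => [j' ->|->].
  rewrite unlift_none; congr cons_sum; congr word_sum.
  by apply/funext => j; rewrite liftK.
- move=> [[|l] [f [Hf ->]]]; [by left|right].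
  exists (f ord0), (word_sum (fun j => f (lift ord0 j))); split=> //.
    exact: (Hf ord0).
  by apply/word_sumsP; exists l, (fun j => f (lift ord0 j)); split=> // j;
    apply: (Hf (lift ord0 j)).
Qed.

Lemma letterE (c : rat) (f g : letter) i : (c *: f + g) i = c *: f i + g i.
Proof. by []. Qed.

Lemma cons_sum_linearl F : linear (cons_sum^~ F).
Proof.
move=> c f g; apply/funext => M; rewrite letterE /cons_sum scaler_sumr.
by rewrite -big_split; apply: eq_bigr => i _; rewrite letterE mulrDl -scalerAl.
Qed.

Lemma cons_sum_linearr f : linear (cons_sum f).
Proof.
move=> c F G; apply/funext => M; rewrite letterE /cons_sum scaler_sumr.
by rewrite -big_split; apply: eq_bigr => i _; rewrite letterE mulrDr -scalerAr.
Qed.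

Lemma sum_lim_linear : linear sum_lim.
Proof. by move=> c F G; apply/fpsP => N. Qed.

Lemma lin_span_cons_sum (H G S : set letter) f F :
  lin_span H f -> lin_span G F ->
  (forall f' F', H f' -> G F' -> lin_span S (cons_sum f' F')) ->
  lin_span S (cons_sum f F).
Proof.
move=> Hf GF HGS; move: f Hf.
apply: (lin_span_linear (cons_sum_linearl F)) => f Hf; move: F GF.
by apply: (lin_span_linear (cons_sum_linearr f)) => F; apply: HGS.
Qed.

Lemma word_sums_span (G G' : set letter) : G `<=` lin_span G' ->
  word_sums G `<=` lin_span (word_sums G').
Proof.
move=> GG' F; elim=> [|f F' Gf _ IH].
  by apply: mem_lin_span; constructor.
apply: (lin_span_cons_sum (GG' _ Gf) IH) => *.
by apply: mem_lin_span; constructor.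
Qed.

Lemma headed_sums_span (H G H' G' : set letter) : H `<=` lin_span H' ->
  G `<=` lin_span G' -> headed_sums H G `<=` lin_span (headed_sums H' G').
Proof.
move=> HH' GG' F [->|[f [F' [Hf GF' ->]]]]; first by apply: mem_lin_span; left.
apply: (lin_span_cons_sum (HH' _ Hf) (word_sums_span GG' GF')) => f1 F1 *.
by apply: mem_lin_span; right; exists f1, F1.
Qed.

(** Allows spans to be compared at the level of truncated sums, as functions of M, before the limit
    is taken. *)
Lemma lin_span_sum_lim (S S' : set letter) : lin_span S = lin_span S' ->
  lin_span (sum_lim @` S) = lin_span (sum_lim @` S').
Proof.
suff sub T T' : T `<=` lin_span T' ->
    sum_lim @` T `<=` lin_span (sum_lim @` T').
  move=> SS'; apply: lin_span_eq; apply: sub => F SF.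
    by rewrite -SS'; apply: mem_lin_span.
  by rewrite SS'; apply: mem_lin_span.
move=> TT' _ [F /TT' + <-].
apply: (lin_span_linear sum_lim_linear) => F' TF'.
by apply: mem_lin_span; exists F'.
Qed.

(** * Polynomial bases with one member in each degree; binomial polynomials *)

Section PolyBasis.
Variable b : nat -> {poly rat}.
Hypothesis size_b : forall j, size (b j) = j.+1.

(** The system is triangular: subtracting the multiple of [b n] with the same coefficient of degree
    n lowers the size. *)
Lemma lin_span_poly_basis n (p : {poly rat}) : (size p <= n)%N ->
  lin_span (b @` `I_n) p.
Proof.
elim: n p => [|n IHn] p.
  by rewrite leqn0 size_poly_eq0 => /eqP ->; apply: lin_span0.
move=> pn; have bn0 : (b n)`_n != 0.
  by rewrite -[n in _`_n]/(n.+1.-1) -(size_b n) -lead_coefE lead_coef_eq0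
     -size_poly_eq0 size_b.
rewrite -[p](subrK ((p`_n / (b n)`_n) *: b n)); apply: lin_spanD; last first.
  by apply/lin_spanZ/mem_lin_span; exists n => /=.
suff /IHn : (size (p - (p`_n / (b n)`_n) *: b n)%R <= n)%N.
  apply: lin_span_sub => _ [j /= jn <-]; apply: mem_lin_span.
  by exists j => //=; apply: ltnW.
apply/leq_sizeP => j; rewrite leq_eqVlt coefB coefZ => /orP[/eqP <-|nj].
  by rewrite divfK // subrr.
have -> : p`_j = 0 by apply/nth_default/(leq_trans pn).
by rewrite [(b n)`_j]nth_default ?size_b // mulr0 subrr.
Qed.

Lemma lin_span_poly p : lin_span (range b) p.
Proof.
apply: lin_span_sub (lin_span_poly_basis (leqnn (size p))) => _ [j _ <-].
by apply: mem_lin_span; exists j.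
Qed.

(** The projection f - f(0) fixes p and every [b j.+1], and kills the constant [b 0]; apply it to an
    expansion of p in the whole basis. *)
Lemma lin_span_poly0 p : (forall j, (b j.+1).[0] = 0) -> p.[0] = 0 ->
  lin_span (range (b \o S)) p.
Proof.
move=> b0 p0; rewrite -[p]subr0 -[0](polyC0) -p0.
pose h (f : {poly rat}) := f - (f.[0])%:P.
have hlin : linear h.
  move=> c f g.
  by rewrite /h hornerD hornerZ polyCD polyCM mul_polyC opprD addrACA scalerBr.
apply: (lin_span_linear hlin _ (lin_span_poly p)) => _ [[|j] _ <-]; last first.
  by rewrite /h b0 subr0; apply: mem_lin_span; exists j.
have /size_poly1P[c _ ->] : size (b 0%N) == 1%N by rewrite size_b.
by rewrite /h hornerC subrr; apply: lin_span0.
Qed.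

End PolyBasis.

Definition bin_poly k : {poly rat} :=
  (k`!%:R)^-1 *: \prod_(j < k) ('X - (j%:R)%:P).

Lemma fact_neq0 n : n`!%:R != 0 :> rat.
Proof. by rewrite pnatr_eq0 -lt0n fact_gt0. Qed.

Lemma size_bin_poly k : size (bin_poly k) = k.+1.
Proof.
rewrite size_scale ?invr_eq0 ?fact_neq0 // size_prod_XsubC.
by rewrite /index_enum -enumT size_enum_ord.
Qed.

(** Multiplied by k!, both sides are the falling factorial of M; for M < k the product contains the
    factor M - M. *)
Lemma horner_bin_poly k M : (bin_poly k).[M%:R] = 'C(M, k)%:R.
Proof.
rewrite hornerZ horner_prod; apply: (mulfI (fact_neq0 k)).
rewrite mulVKf ?fact_neq0 // -natrM mulnC bin_ffact.
under eq_bigr do rewrite hornerXsubC.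
case: (leqP k M) => [kM|Mk].
  rewrite ffact_prod natr_prod; apply: eq_bigr => i _; rewrite natrB //.
  exact: ltnW (leq_trans (ltn_ord i) kM).
by rewrite ffact_small // (bigD1 (Ordinal Mk)) //= subrr mul0r.
Qed.

(* The polynomial taking the values of the binomial coefficients of
   [v + j - 1] over [j], so that the sum over [v > 0] of [(mbin_poly j)(v) t^v]
   is [t / (1 - t) ^ (j + 1)]. *)
Definition mbin_poly j : {poly rat} :=
  bin_poly j \Po ('X + (j%:R - 1)%:P).

Lemma size_mbin_poly j : size (mbin_poly j) = j.+1.
Proof. by rewrite size_comp_poly2 ?size_bin_poly // size_XaddC. Qed.

Lemma horner_mbin_poly j v : (mbin_poly j).[v%:R] = 'C((v + j).-1, j)%:R.
Proof.
(* For j = 0 the predecessor truncates at v = 0, which is harmless since [bin_poly 0] is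
   constant. *)
case: j => [|j].
  by rewrite /mbin_poly /bin_poly big_ord0 comp_polyZ comp_polyC hornerZ hornerC
    fact0 invr1 mulr1 bin0.
rewrite horner_comp hornerD hornerX hornerC addnS /= -addn1 -horner_bin_poly.
by rewrite natrD addrK natrD.
Qed.

(** For j > 0 this is the binomial coefficient of j - 1 over j. It is why poles of index j >= 1
    correspond to polynomials vanishing at 0. *)
Lemma horner0_mbin_poly j : (mbin_poly j).[0] = (j == 0%N)%:R.
Proof.
by rewrite (horner_mbin_poly j 0%N) add0n; case: j => // j; rewrite bin_small.
Qed.

(** * Poles as power series with polynomial coefficients *)

Lemma dvdn_succ_quotient i N : (i.+1 %| N)%N -> (0 < N)%N ->
  exists2 v, N = (i.+1 * v.+1)%N & (N %/ i.+1)%N = v.+1.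
Proof.
move=> /dvdnP[[|v] ->] //; exists v; first by rewrite mulnC.
by rewrite mulnK.
Qed.

(** With n = i + 1, this is the sum over v > 0 of P(v) q^(n v); the test [0 < N] excludes v = 0. *)
Definition pol_letter (P : {poly rat}) : letter := fun i =>
  Fps (fun N => if (0 < N)%N && (i.+1 %| N)%N then P.[(N %/ i.+1)%:R] else 0).

Definition pole_letter (j : nat) : letter := fun i =>
  fps_q ^+ i.+1 / (1 - fps_q ^+ i.+1) ^+ j.+1.

Lemma pol_letter_linear : linear pol_letter.
Proof.
move=> c P Q; apply/funext => i; apply/fpsP => N; rewrite letterE /=.
by case: ifP; rewrite ?hornerD ?hornerZ ?mulr0 ?addr0.
Qed.

(** Multiplying by 1 - q^n turns the coefficients P(v) into P(v) - P(v-1), except at v = 1, where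
    nothing is subtracted; the last term restores this P(0). *)
Lemma pol_letter_diff (P P1 : {poly rat}) i :
  (forall v, P.[v.+1%:R] - P.[v%:R] = P1.[v.+1%:R]) ->
  (1 - fps_q ^+ i.+1) * pol_letter P i =
    pol_letter P1 i + P.[0] *: fps_q ^+ i.+1.
Proof.
move=> PP1; apply/fpsP => N.
rewrite mulrBl mul1r [LHS]fcoefD fcoefN fcoef_qnM fcoefD fcoefZ fcoef_qn /=.
have [/dvdn_succ_quotient/= nN|nN] := boolP (i.+1 %| N)%N; last first.
  rewrite andbF add0r; have -> : (N == i.+1) = false.
    by apply: contraNF nN => /eqP->.
  rewrite mulr0 addr0; case: leqP => iN /=; first by rewrite oppr0.
  by rewrite dvdn_subl ?(negPf nN) ?andbF ?oppr0.
case: (posnP N) nN => [-> _|N0 /(_ isT)[v Nv Ndiv]] /=.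
  by rewrite mulr0 subr0.
rewrite Ndiv Nv leq_pmulr // -[X in (_ * _ - X)%N]muln1 -mulnBr subSS subn0.
rewrite dvdn_mulr // mulKn // muln_gt0 /= -PP1 andbT.
case: v {Nv Ndiv} => [|v] /=.
  by rewrite muln1 eqxx mulr1 subr0 subrK.
by rewrite -[X in _ == X]muln1 eqn_pmul2l // mulr0 addr0.
Qed.

Lemma unit_one_subq i : 1 - fps_q ^+ i.+1 \is a GRing.unit.
Proof. exact: fps_unit_1subq. Qed.

(** After clearing denominators, induct on j: by Pascal's rule a factor 1 - q^n lowers the index of
    [mbin_poly] by one, and the last factor leaves q^n. *)
Lemma pole_letterE j : pole_letter j = pol_letter (mbin_poly j).
Proof.
apply/funext => i; have u := unit_one_subq i.
apply: (mulrI (unitrX j.+1 u)); rewrite /pole_letter mulrCA mulrV ?unitrX //.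
rewrite mulr1; apply/esym; elim: j => [|j IHj].
  rewrite expr1 (@pol_letter_diff _ 0) => [|v]; last first.
    by rewrite !horner_mbin_poly !bin0 horner0 subrr.
  rewrite horner0_mbin_poly scale1r; apply/fpsP => N.
  by rewrite fcoefD /= horner0 if_same add0r.
rewrite exprSr -mulrA (@pol_letter_diff _ (mbin_poly j)) => [|v]; last first.
  by rewrite !horner_mbin_poly !addnS !addSn /= binS natrD addrAC subrr add0r.
by rewrite horner0_mbin_poly scale0r addr0.
Qed.

(** Divide 1 = (1 - x) + x by (1 - x)^(k+1), where x = q^(i+1). *)
Lemma pole_letterS k i : (1 - fps_q ^+ i.+1) ^- k.+1 =
  (1 - fps_q ^+ i.+1) ^- k + pole_letter k i.
Proof.
have u := unit_one_subq i; apply: (mulIr (unitrX k.+1 u)).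
rewrite mulVr ?unitrX // /pole_letter mulrDl divrK ?unitrX //.
by rewrite [_ ^+ k.+1]exprSr mulrA mulVr ?unitrX // mul1r subrK.
Qed.

Section PolLetterSpan.
Variable b : nat -> {poly rat}.
Hypothesis size_b : forall j, size (b j) = j.+1.

Lemma pol_letter_span P :
  lin_span (range (fun j => pol_letter (b j))) (pol_letter P).
Proof.
apply: (lin_span_linear pol_letter_linear) (lin_span_poly size_b P).
by move=> _ [j _ <-]; apply: mem_lin_span; exists j.
Qed.

Lemma pol_letter_span0 P : (forall j, (b j.+1).[0] = 0) -> P.[0] = 0 ->
  lin_span (range (fun j => pol_letter (b j.+1))) (pol_letter P).
Proof.
move=> b0 P0; have := lin_span_poly0 size_b b0 P0.
apply: (lin_span_linear pol_letter_linear) => _ [j _ <-].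
by apply: mem_lin_span; exists j.
Qed.

End PolLetterSpan.

(** * Exchanging polynomial weights and letters 1 *)

(** On a nested sum the weight is evaluated at the bound M, on a letter at i = n - 1. These agree
    inside [cons_sum], so weights pass freely between a letter and its tail. *)
Definition poly_mul (p : {poly rat}) (F : letter) : letter :=
  fun M => p.[M%:R] *: F M.

Definition poles : set letter := range pole_letter.
Definition unit_poles : set letter := [set f | f = (fun=> 1) \/ poles f].
Definition poly_poles : set letter :=
  [set f | exists p j, f = poly_mul p (pole_letter j)].

Lemma poly_mul_linearl F : linear (poly_mul^~ F).
Proof.
move=> c p q; apply/funext => M; rewrite letterE /poly_mul hornerD hornerZ.
by rewrite scalerDl scalerA.
Qed.

Lemma poly_mul_linearr p : linear (poly_mul p).
Proof.
move=> c F G; apply/funext => M; rewrite letterE /poly_mul letterE.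
by rewrite scalerDr !scalerA mulrC.
Qed.

Lemma poly_mul1 F : poly_mul 1 F = F.
Proof. by apply/funext => M; rewrite /poly_mul hornerC scale1r. Qed.

Lemma poly_mulM p q F : poly_mul p (poly_mul q F) = poly_mul (p * q) F.
Proof. by apply/funext => M; rewrite /poly_mul hornerM scalerA. Qed.

Lemma cons_sum_poly_mul p f F :
  cons_sum f (poly_mul p F) = cons_sum (poly_mul p f) F.
Proof.
apply/funext => M; apply: eq_bigr => i _.
by rewrite /poly_mul -scalerAr scalerAl.
Qed.

Lemma cons_sumS f F M : cons_sum f F M.+1 = cons_sum f F M + f M * F M.
Proof. exact: big_ord_recr. Qed.

(** The hockey-stick identity. *)
Lemma cons_sum1_bin k : cons_sum (fun=> 1) (poly_mul (bin_poly k) (fun=> 1)) =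
  poly_mul (bin_poly k.+1) (fun=> 1).
Proof.
apply/funext; elim=> [|M IHM].
  by rewrite /cons_sum big_ord0 /poly_mul horner_bin_poly scale0r.
rewrite cons_sumS IHM mul1r /poly_mul !horner_bin_poly binS natrD.
by rewrite scalerDl.
Qed.

(* Summation by parts. *)
Lemma cons_sum1_bin_cons k f F :
  cons_sum (fun=> 1) (poly_mul (bin_poly k) (cons_sum f F)) =
  poly_mul (bin_poly k.+1) (cons_sum f F) -
  cons_sum (poly_mul (bin_poly k.+1 \Po ('X + 1)) f) F.
Proof.
suff E M : cons_sum (fun=> 1) (poly_mul (bin_poly k) (cons_sum f F)) M +
    cons_sum (poly_mul (bin_poly k.+1 \Po ('X + 1)) f) F M =
    poly_mul (bin_poly k.+1) (cons_sum f F) M.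
  by apply/eqP; rewrite eq_sym subr_eq eq_sym; apply/eqP/funext.
elim: M => [|M IHM].
  by rewrite /poly_mul /cons_sum !big_ord0 scaler0 addr0.
rewrite !cons_sumS addrACA IHM mul1r /poly_mul horner_comp hornerD hornerX.
rewrite hornerC natr1 !horner_bin_poly cons_sumS -scalerAl scalerDr addrA.
by congr (_ + _); rewrite -scalerDl binS natrD.
Qed.

Lemma lin_span_bin_poly p : lin_span (range bin_poly) p.
Proof. exact/lin_span_poly/size_bin_poly. Qed.

(* A run of letters [1] between two poles, or after the last pole, contributes
   a polynomial in the neighbouring indices. *)
Lemma unit_poles_sub F : word_sums unit_poles F ->
  lin_span
    [set G | exists p F', word_sums poly_poles F' /\ G = poly_mul p F'] F.
Proof.
set T := [set G | _].
elim=> [|f F' uf _ IH].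
  by apply: mem_lin_span; exists 1, (fun=> 1); rewrite poly_mul1;
    split=> //; constructor.
move: F' IH.
apply: (lin_span_linear (cons_sum_linearr f)) => G [p [F' [wF' ->]]].
(* A pole absorbs the weight of its tail, leaving the outer weight 1. *)
case: uf => [->|[j _ <-]]; last first.
  rewrite cons_sum_poly_mul -[cons_sum _ _]poly_mul1; apply: mem_lin_span.
  by exists 1; eexists; split; [|reflexivity]; constructor=> //; exists p, j.
(* For a letter 1 the weight is expanded in binomial polynomials. Before an empty tail the
   hockey-stick identity applies, before a weighted pole summation by parts. *)
have lin : linear (fun p => cons_sum (fun=> 1) (poly_mul p F')).
  by move=> c p1 p2; rewrite poly_mul_linearl cons_sum_linearr.
apply: (lin_span_linear lin) (lin_span_bin_poly p) => _ [k _ <-].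
case: wF' => [|_ F1 [q [j ->]] wF1].
  rewrite cons_sum1_bin; apply: mem_lin_span; exists (bin_poly k.+1), (fun=> 1).
  by split=> //; constructor.
rewrite cons_sum1_bin_cons -scaleN1r; apply: lin_spanD; [|apply: lin_spanZ];
  apply: mem_lin_span.
  exists (bin_poly k.+1); eexists; split; [|reflexivity].
  by constructor=> //; exists q, j.
rewrite poly_mulM -[cons_sum _ _]poly_mul1; exists 1; eexists.
by split; [|reflexivity]; constructor=> //; eexists; exists j.
Qed.

(** Induction on the word, and for binomial weights on k: summation by parts, solved for the term of
    weight k + 1, gives a letter 1 followed by the case k, plus a sum whose weight sits on its first
    pole. *)
Lemma poly_poles_sub F : word_sums poly_poles F ->
  forall p, lin_span (word_sums unit_poles) (poly_mul p F).
Proof.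
elim=> [|_ F' [q [j ->]] _ IH] p.
  apply: (lin_span_linear (poly_mul_linearl _)) (lin_span_bin_poly p).
  move=> _ [k _ <-]; apply: mem_lin_span; elim: k => [|k IHk].
    rewrite [bin_poly 0](_ : _ = 1) ?poly_mul1; first by constructor.
    by rewrite /bin_poly big_ord0 fact0 invr1 scale1r.
  by rewrite -cons_sum1_bin; constructor=> //; left.
(* A weight on the first pole moves to the tail, where the induction hypothesis accepts any
   polynomial. *)
have base r : lin_span (word_sums unit_poles)
    (cons_sum (poly_mul r (pole_letter j)) F').
  rewrite -cons_sum_poly_mul; move: (IH r).
  apply: (lin_span_linear (cons_sum_linearr _)) => G wG; apply: mem_lin_span.
  by constructor=> //; right; exists j.
apply: (lin_span_linear (poly_mul_linearl _)) (lin_span_bin_poly p).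
move=> _ [k _ <-]; elim: k => [|k IHk].
  rewrite [bin_poly 0](_ : _ = 1) ?poly_mul1 //.
  by rewrite /bin_poly big_ord0 fact0 invr1 scale1r.
have /eqP := cons_sum1_bin_cons k (poly_mul q (pole_letter j)) F'.
rewrite eq_sym subr_eq => /eqP ->; rewrite poly_mulM; apply: lin_spanD => //.
move: IHk; apply: (lin_span_linear (cons_sum_linearr _)) => G wG.
by apply: mem_lin_span; constructor=> //; left.
Qed.

(** The core of (i). The leading pole absorbs the weight that remains after the letters 1 are summed
    out; conversely it hands its own weight to the tail. *)
Lemma headed_unit_poles_span :
  lin_span (headed_sums poles unit_poles) = lin_span (word_sums poly_poles).
Proof.
apply: lin_span_eq => F.
  case=> [->|[_ [F' [[j _ <-] wF' ->]]]].
    by apply: mem_lin_span; constructor.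
  move: (unit_poles_sub wF'); apply: (lin_span_linear (cons_sum_linearr _)).
  move=> _ [p [F1 [wF1 ->]]]; rewrite cons_sum_poly_mul; apply: mem_lin_span.
  by constructor=> //; exists p, j.
case=> [|_ F' [p [j ->]] wF']; first by apply: mem_lin_span; left.
rewrite -cons_sum_poly_mul; move: (poly_poles_sub wF' p).
apply: (lin_span_linear (cons_sum_linearr _)) => G wG; apply: mem_lin_span.
by right; exists (pole_letter j), G; split=> //; exists j.
Qed.

(** * Letters of q-zeta values and of bi-brackets *)

Definition zeta_letter s (Q : {poly rat}) : letter := fun i =>
  horner_alg (fps_q ^+ i.+1) Q / (1 - fps_q ^+ i.+1) ^+ s.

(** The shift to X + 1 compensates for [poly_mul] evaluating at i = n - 1, so that the weight is n^r
    / r! with n in the role of u. *)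
Definition bi_letter s r : letter := poly_mul
  ((r`!%:R)^-1 *: ('X + 1) ^+ r) (pol_letter ((s.-1`!%:R)^-1 *: 'X ^+ s.-1)).

Lemma zeta_letter_linear s : linear (zeta_letter s).
Proof.
move=> c P Q; apply/funext => i; rewrite letterE /zeta_letter linearP /=.
by rewrite mulr_algl mulrDl -scalerAl.
Qed.

Lemma size_exp_degree1 (p : {poly rat}) j : size p = 2 -> size (p ^+ j) = j.+1.
Proof.
move=> p2; have p0 : p != 0 by rewrite -size_poly_eq0 p2.
elim: j => [|j IHj]; first by rewrite expr0 size_poly1.
by rewrite exprS size_mul ?expf_neq0 // p2 IHj.
Qed.

Lemma size_divided_exp (p : {poly rat}) j : size p = 2 ->
  size ((j`!%:R)^-1 *: p ^+ j) = j.+1.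
Proof.
by move=> p2; rewrite size_scale ?invr_eq0 ?fact_neq0 // size_exp_degree1.
Qed.

Lemma size_subX1_exp j : size ((1 - 'X) ^+ j : {poly rat}) = j.+1.
Proof.
by apply: size_exp_degree1; rewrite -opprB size_polyN -polyC1 size_XsubC.
Qed.

Lemma horner_alg_subX1 (x : fps) : horner_alg x (1 - 'X) = 1 - x.
Proof. by rewrite rmorphB rmorph1 /= horner_algX. Qed.

(** Expand Q in powers of 1 - X: the term of exponent j < n becomes the pole of index s - j - 1 >= s
    - n. *)
Lemma zeta_letter_mulX s n (Q : {poly rat}) : (size Q <= n <= s)%N ->
  lin_span (pole_letter @` [set k | (s - n <= k)%N]) (zeta_letter s (Q * 'X)).
Proof.
move=> /andP[Qn ns].
have lin : linear (fun P => zeta_letter s (P * 'X)).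
  by move=> c P P'; rewrite mulrDl -scalerAl zeta_letter_linear.
have := lin_span_poly_basis size_subX1_exp Qn.
apply: (lin_span_linear lin) => _ [j /= jn <-].
apply: mem_lin_span; exists (s - j.+1)%N; first exact: leq_sub2l.
apply/funext => i; rewrite /pole_letter /zeta_letter rmorphM rmorphXn /=.
rewrite horner_alg_subX1 horner_algX -(subnK (leq_trans jn ns)) addnK.
have u := unit_one_subq i; rewrite addnS -addSn exprD invrM ?unitrX //.
by rewrite [_ ^+ j * _]mulrC -mulrA mulVKr ?unitrX.
Qed.

(** Here n bounds deg Q: n = s allows all poles, and n = s - 1 with s >= 1 only those of index at
    least 1. *)
Lemma zeta_letter_poles s Q n : tQt Q -> (size Q <= n.+1)%N -> (n <= s)%N ->
  lin_span (pole_letter @` [set k | (s - n <= k)%N]) (zeta_letter s Q).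
Proof.
move=> /dvdpP[P ->] PX ns; apply: zeta_letter_mulX; rewrite ns andbT.
have [->|P0] := eqVneq P 0; first by rewrite size_poly0.
by rewrite size_mulX in PX.
Qed.

(** In powers of 1 - X, the quotient becomes a combination of inverse powers of 1 - x, each of which
    [pole_letterS] unwinds down to the letter 1. *)
Lemma zeta_letter_unit_poles s (Q : {poly rat}) : (size Q <= s.+1)%N ->
  lin_span unit_poles (zeta_letter s Q).
Proof.
move=> Qs; have := lin_span_poly_basis size_subX1_exp Qs.
apply: (lin_span_linear (@zeta_letter_linear s)) => _ [j /= js <-].
rewrite [zeta_letter _ _](_ : _ = fun i => (1 - fps_q ^+ i.+1) ^- (s - j)).
  elim: (s - j)%N => [|k IHk].
    rewrite [X in lin_span _ X](_ : _ = fun=> 1); last first.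
      by apply/funext => i; rewrite expr0 invr1.
    by apply: mem_lin_span; left.
  rewrite [X in lin_span _ X](_ : _ =
    (fun i => (1 - fps_q ^+ i.+1) ^- k) + pole_letter k); last first.
    by apply/funext => i; apply: pole_letterS.
  by apply: lin_spanD => //; apply: mem_lin_span; right; exists k.
apply/funext => i; rewrite /zeta_letter rmorphXn /= horner_alg_subX1.
have u := unit_one_subq i.
apply: (mulIr (unitrX s u)); rewrite divrK ?unitrX //.
by rewrite -[in RHS](@subnK j s js) addnK exprD mulKr ?unitrX.
Qed.

Lemma pole_zeta_letter j : pole_letter j = zeta_letter j.+1 'X.
Proof. by apply/funext => i; rewrite /zeta_letter /= horner_algX. Qed.

Lemma unit_zeta_letter : (fun=> 1) = zeta_letter 1 (1 - 'X).
Proof.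
apply/funext => i; rewrite /zeta_letter horner_alg_subX1 expr1 divrr //.
exact: unit_one_subq.
Qed.

Lemma bi_letter0 s : bi_letter s 0 =
  pol_letter ((s.-1`!%:R)^-1 *: 'X ^+ s.-1).
Proof. by rewrite /bi_letter expr0 fact0 invr1 scale1r poly_mul1. Qed.

Lemma bi_letter0_poles s : lin_span poles (bi_letter s 0).
Proof.
rewrite bi_letter0; have := pol_letter_span size_mbin_poly.
move=> /(_ ((s.-1`!%:R)^-1 *: 'X ^+ s.-1)); apply: lin_span_sub => _ [j _ <-].
by apply: mem_lin_span; exists j => //; rewrite pole_letterE.
Qed.

Lemma bi_letter0_poles1 s : (2 <= s)%N ->
  lin_span (pole_letter @` [set k | (1 <= k)%N]) (bi_letter s 0).
Proof.
case: s => [|[|s]] // _; rewrite bi_letter0; set P := _ *: _.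
have P0 : P.[0] = 0 by rewrite hornerZ hornerXn exprS mul0r mulr0.
have b0 j : (mbin_poly j.+1).[0] = 0 by rewrite horner0_mbin_poly.
have := pol_letter_span0 size_mbin_poly b0 P0.
apply: lin_span_sub => _ [j _ <-].
by apply: mem_lin_span; exists j.+1 => //; rewrite pole_letterE.
Qed.

Lemma size_divided_Xn j : size ((j`!%:R)^-1 *: 'X ^+ j : {poly rat}) = j.+1.
Proof. by apply: size_divided_exp; rewrite size_polyX. Qed.

Lemma pole_bi_letter0 j :
  lin_span [set f | exists s, (1 <= s)%N /\ f = bi_letter s 0] (pole_letter j).
Proof.
rewrite pole_letterE; have := pol_letter_span size_divided_Xn (mbin_poly j).
apply: lin_span_sub => _ [k _ <-]; apply: mem_lin_span.
by exists k.+1; rewrite bi_letter0.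
Qed.

Lemma pole_bi_letter0_1 j : (1 <= j)%N ->
  lin_span [set f | exists s, (2 <= s)%N /\ f = bi_letter s 0] (pole_letter j).
Proof.
case: j => // j _; rewrite pole_letterE.
have b0 k : ((k.+1`!%:R)^-1 *: 'X ^+ k.+1 : {poly rat}).[0] = 0.
  by rewrite hornerZ hornerXn exprS mul0r mulr0.
have P0 : (mbin_poly j.+1).[0] = 0 by rewrite horner0_mbin_poly.
have := pol_letter_span0 size_divided_Xn b0 P0.
apply: lin_span_sub => _ [k _ <-]; apply: mem_lin_span.
by exists k.+2; rewrite bi_letter0.
Qed.

Lemma bi_letter_poly_poles s r : lin_span poly_poles (bi_letter s r).
Proof.
rewrite /bi_letter -bi_letter0; set p := _ *: _.
apply: (lin_span_linear (poly_mul_linearr p)) (bi_letter0_poles s).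
by move=> _ [j _ <-]; apply: mem_lin_span; exists p, j.
Qed.

Lemma poly_poles_bi_letter f : poly_poles f ->
  lin_span [set f | exists s r, (1 <= s)%N /\ f = bi_letter s r] f.
Proof.
move=> [p [j ->]]; apply: (lin_span_linear (poly_mul_linearr p))
  (pole_bi_letter0 j) => _ [s [s1 ->]].
(* Powers of X + 1 also have one member in each degree, so every weight p expands in the weights of
   bi-brackets. *)
have size_b r : size ((r`!%:R)^-1 *: ('X + 1) ^+ r : {poly rat}) = r.+1.
  by apply: size_divided_exp; rewrite -polyC1 size_XaddC.
apply: (lin_span_linear (poly_mul_linearl _)) (lin_span_poly size_b p).
move=> _ [r _ <-]; apply: mem_lin_span; exists s, r; split=> //.
by rewrite bi_letter0.
Qed.

(** * The series as limits of nested sums *)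

Lemma fcoef_sum (I : Type) (r : seq I) (P : pred I) (F : I -> fps) N :
  fcoef (\sum_(i <- r | P i) F i) N = \sum_(i <- r | P i) fcoef (F i) N.
Proof. exact: (big_morph (fun f => fcoef f N)). Qed.

Definition dec_ffun (l K : nat) (m : {ffun 'I_l -> 'I_K}) : bool :=
  [forall i : 'I_l, forall j : 'I_l, (i < j)%N ==> (m j < m i)%N].

Definition ffun_cons (l : nat) (T : Type) (p : T * {ffun 'I_l -> T}) :
    {ffun 'I_l.+1 -> T} :=
  [ffun j => if unlift ord0 j is Some j' then p.2 j' else p.1].

Lemma ffun_cons_bij l T : bijective (@ffun_cons l T).
Proof.
exists (fun m : {ffun _ -> T} => (m ord0, [ffun j : 'I_l => m (lift ord0 j)]))
  => [[i m]|m].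
  congr pair; first by rewrite ffunE unlift_none.
  by apply/ffunP => j; rewrite !ffunE liftK.
apply/ffunP => j; rewrite ffunE.
by case: unliftP => [j' ->|->] //=; rewrite ffunE.
Qed.

Lemma dec_ffun_cons l K (i : 'I_K) (m : {ffun 'I_l -> 'I_K}) :
  dec_ffun (ffun_cons (i, m)) = dec_ffun m && [forall j, (m j < i)%N].
Proof.
apply/idP/idP => [/'forall_forallP dec|/andP[/'forall_forallP dec /forallP mi]].
  apply/andP; split.
    apply/'forall_forallP => j k; have := dec (lift ord0 j) (lift ord0 k).
    by rewrite !ffunE !liftK !lift0 ltnS.
  apply/forallP => j; have := dec ord0 (lift ord0 j).
  by rewrite !ffunE unlift_none liftK.
apply/'forall_forallP => j k; rewrite !ffunE.
case: unliftP => [j' ->|->]; case: unliftP => [k' ->|->] //.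
  by rewrite !lift0 ltnS; apply: dec.
by rewrite mi implybT.
Qed.

(** The ambient bound K stays fixed while M drops to the head index for the tail, so that the
    induction keeps a single codomain ['I_K]. *)
Lemma word_sum_ffun l (f : 'I_l -> letter) K M : (M <= K)%N ->
  word_sum f M =
  \sum_(m : {ffun 'I_l -> 'I_K} | dec_ffun m && [forall j, (m j < M)%N])
     \prod_j f j (m j).
Proof.
elim: l f M => [|l IHl] f M MK.
  rewrite (big_pred1 (ffun0 (card_ord 0))) ?big_ord0 // => m.
  rewrite /= [m](_ : _ = ffun0 (card_ord 0)) ?eqxx; last by apply/ffunP => -[].
  by apply/andP; split; apply/forallP => -[].
rewrite (reindex _ (onW_bij _ (@ffun_cons_bij l 'I_K))) /= /cons_sum.
rewrite (big_ord_widen _ (fun i => f ord0 i * word_sum _ i) MK).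
under [LHS]eq_bigr => i iM.
  rewrite (IHl _ _ (ltnW (ltn_ord i))) mulr_sumr; over.
rewrite pair_big_dep; apply: eq_big => [[i m]|[i m] _] /=.
  rewrite dec_ffun_cons andbCA -andbA; congr (_ && _).
  apply/idP/idP => [/andP[iM /forallP mi]|/andP[-> /forallP mM]].
    apply/andP; split; first exact/forallP.
    apply/forallP => j; rewrite ffunE.
    by case: unliftP => // j' _; apply: ltn_trans iM.
  by have := mM ord0; rewrite ffunE unlift_none andbT.
rewrite big_ord_recl ffunE unlift_none; congr (_ * _).
by apply: eq_bigr => j _; rewrite ffunE liftK.
Qed.

(** Turns a coefficient of an infinite family into a finite sum; [h] only has to reach the indices
    with a nonzero contribution. *)
Lemma fsum_finType (I : choiceType) (A : set I) (F : I -> rat) (T : finType)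
    (P : pred T) (h : T -> I) : injective h -> (forall t, P t -> A (h t)) ->
    (forall x, A x -> F x != 0 -> exists2 t, P t & h t = x) ->
  \sum_(x \in A) F x = \sum_(t | P t) F (h t).
Proof.
move=> inj PA AF; rewrite (fsbigE (map h (enum P))).
- rewrite big_map big_enum_cond; apply: eq_bigl => t.
  by apply: andb_idr => Pt; apply/mem_set/PA.
- by rewrite map_inj_uniq ?enum_uniq.
- by move=> _ /mapP[t + ->]; rewrite mem_enum => /PA.
- move=> x Ax; apply: contraNeq => /(AF _ Ax)[t Pt <-].
  by apply: map_f; rewrite mem_enum.
Qed.

Definition shift_ffun l K (m : {ffun 'I_l -> 'I_K}) : {ffun 'I_l -> nat} :=
  [ffun j => (m j).+1].

Lemma shift_ffun_inj l K : injective (@shift_ffun l K).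
Proof.
move=> m m' /ffunP mm'; apply/ffunP => j; apply: val_inj.
by have := mm' j; rewrite !ffunE => -[].
Qed.

Lemma shift_ffun_dec_pos l K (m : {ffun 'I_l -> 'I_K}) :
  dec_ffun m -> dec_pos (shift_ffun m).
Proof.
move=> /'forall_forallP dec; split=> [i j ij|i]; rewrite !ffunE //.
by rewrite ltnS (implyP (dec i j)).
Qed.

Lemma shift_ffun_surj l K (n : {ffun 'I_l -> nat}) :
  (forall j, 0 < n j <= K)%N ->
  exists m : {ffun 'I_l -> 'I_K}, shift_ffun m = n.
Proof.
move=> nK; have nK' j : ((n j).-1 < K)%N.
  by have /andP[n0] := nK j; rewrite prednK.
exists [ffun j => Ordinal (nK' j)]; apply/ffunP => j; rewrite !ffunE /=.
by have /andP[n0 _] := nK j; rewrite prednK.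
Qed.

Lemma dec_pos_shift_ffun l K (n : {ffun 'I_l -> nat}) : dec_pos n ->
  (forall j, (n j <= K)%N) -> exists2 m : {ffun 'I_l -> 'I_K},
    dec_ffun m & shift_ffun m = n.
Proof.
move=> [dec pos] nK; have [j|m mn] := @shift_ffun_surj l K n.
  by rewrite pos nK.
exists m => //; apply/'forall_forallP => i j; apply/implyP => /dec.
by rewrite -mn !ffunE ltnS.
Qed.

Lemma sum_lim_word_sum l (f : 'I_l -> letter) N :
  fcoef (sum_lim (word_sum f)) N =
  \sum_(m : {ffun 'I_l -> 'I_N} | dec_ffun m) fcoef (\prod_j f j (m j)) N.
Proof.
rewrite /= (word_sum_ffun f (leqnn N)) fcoef_sum; apply: eq_bigl => m.
by rewrite andb_idr // => _; apply/forallP => j; apply: ltn_ord.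
Qed.

Lemma qzetaE l (s : 'I_l -> nat) (Q : 'I_l -> {poly rat}) :
  (forall j : 'I_l, j = 0%N :> nat -> tQt (Q j)) ->
  qzeta s Q = sum_lim (word_sum (fun j => zeta_letter (s j) (Q j))).
Proof.
move=> Q0; apply/fpsP => N; rewrite sum_lim_word_sum /=.
rewrite (fsum_finType (@shift_ffun_inj l N) (@shift_ffun_dec_pos l N)).
  apply: eq_bigr => m _; congr fcoef; apply: eq_bigr => j _.
  by rewrite ffunE.
(* All n_j are at most n_1, and since t divides Q_1 the term is a multiple of q^(n_1); a nonzero
   coefficient of q^N forces n_1 <= N. *)
move=> n ndec nN; apply: dec_pos_shift_ffun => // j.
case: l s Q Q0 n ndec nN j => [|l] s Q Q0 n [ndec _] nN j; first by case: j.
have nj : (n j <= n ord0)%N.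
  case: (posnP j) => [j0|j_gt0]; last exact/ltnW/ndec.
  by rewrite (_ : j = ord0) //; apply: val_inj.
apply: leq_trans nj _; rewrite leqNgt; apply: contra nN => nN; apply/eqP.
rewrite /qzeta_term big_ord_recl; have /dvdpP[P ->] := Q0 ord0 erefl.
have -> x : horner_alg x (P * 'X) = x * horner_alg x P :> fps.
  by rewrite rmorphM /= horner_algX mulrC.
by rewrite -!mulrA fcoef_qnM leqNgt nN.
Qed.

(** Used to cut the sum over v in each letter of a product at v <= N. *)
Lemma fcoef_prod_trunc (I : Type) (r : seq I) (F G : I -> fps) N :
  (forall i k, (k <= N)%N -> fcoef (F i) k = fcoef (G i) k) ->
  forall k, (k <= N)%N ->
    fcoef (\prod_(i <- r) F i) k = fcoef (\prod_(i <- r) G i) k.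
Proof.
move=> FG; elim: r => [|i r IHr] k kN; first by rewrite !big_nil.
rewrite !big_cons !fcoefM; apply: eq_bigr => j _.
rewrite FG ?IHr //; first by rewrite (leq_trans _ kN) ?leq_subr.
by rewrite (leq_trans _ kN) // -ltnS.
Qed.

Lemma pol_letter_trunc P i N k : (k <= N)%N -> fcoef (pol_letter P i) k =
  fcoef (\sum_(v < N) P.[v.+1%:R] *: fps_q ^+ (i.+1 * v.+1)) k.
Proof.
move=> kN; rewrite fcoef_sum.
under eq_bigr do rewrite fcoefZ fcoef_qn.
rewrite /=; case: ifP => [/andP[k0 /dvdn_succ_quotient/(_ k0)[v kv ->]]|nk].
  have vN : (v < N)%N by apply: leq_trans kN; rewrite kv leq_pmull.
  rewrite (bigD1 (Ordinal vN)) //= kv eqxx mulr1 big1 ?addr0 // => w wv.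
  rewrite eqn_pmul2l // eqSS eq_sym -(inj_eq val_inj) in wv *.
  by rewrite (negPf wv) mulr0.
rewrite big1 // => v _; case: eqP => [kE|_]; last by rewrite mulr0.
by move: nk; rewrite kE muln_gt0 dvdn_mulr.
Qed.

(** In the coefficient of q^N each u_j v_j is at most N, which bounds both families by N. For fixed
    u, the product of the truncated sums over v_j is then expanded into a sum over all v. *)
Lemma bibracketE l (s r : 'I_l -> nat) :
  bibracket s r = sum_lim (word_sum (fun j => bi_letter (s j) (r j))).
Proof.
apply/fpsP => N; rewrite sum_lim_word_sum /=.
pose h (mv : {ffun 'I_l -> 'I_N} * {ffun 'I_l -> 'I_N}) :=
  (shift_ffun mv.1, shift_ffun mv.2).
rewrite (@fsum_finType _ _ _ _ (fun mv => dec_ffun mv.1) h); first last.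
- move=> [u v] [/= ndec vpos]; rewrite fcoef_qn.
  case: (N =P _) => [NE _|_]; last by rewrite mulr0 eqxx.
  have uvN j : (u j * v j <= N)%N by rewrite NE (bigD1 j) //= leq_addr.
  have [j|m mdec mu] := @dec_pos_shift_ffun _ N _ ndec.
    by apply: leq_trans (uvN j); rewrite leq_pmulr.
  have [j|w wv] := @shift_ffun_surj _ N v.
    rewrite vpos (leq_trans _ (uvN j)) // leq_pmull //.
    by case: ndec => _; apply.
  by exists (m, w); rewrite // /h mu wv.
- move=> [m w] /= mdec; split; first exact: shift_ffun_dec_pos.
  by move=> j; rewrite ffunE.
- by move=> [m w] [m' w'] [/shift_ffun_inj-> /shift_ffun_inj->].
transitivity (\sum_(m : {ffun 'I_l -> 'I_N} | dec_ffun m)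
    \sum_(w : {ffun 'I_l -> 'I_N}) fcoef (bibracket_term s r (h (m, w))) N).
  by rewrite pair_big_dep; apply: eq_big => -[m w]; rewrite ?andbT.
apply: eq_bigr => m _; rewrite -fcoef_sum.
pose G j (v : 'I_N) : fps :=
  ((m j).+1%:R ^+ r j / (r j)`!%:R) * (v.+1%:R ^+ (s j).-1 / ((s j).-1)`!%:R) *:
  fps_q ^+ ((m j).+1 * v.+1).
rewrite (@fcoef_prod_trunc _ _ _ (fun j => \sum_v G j v) N) //; last first.
  move=> j k kN; rewrite /bi_letter /poly_mul fcoefZ (pol_letter_trunc _ _ kN).
  rewrite hornerZ horner_exp hornerD hornerX hornerC natr1 [_^-1 * _]mulrC.
  rewrite -fcoefZ scaler_sumr; congr fcoef; apply: eq_bigr => v _.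
  by rewrite scalerA hornerZ hornerXn [_^-1 * _]mulrC.
(* Distributivity: a product over j of sums over v_j is a sum over functions v. *)
rewrite bigA_distr_bigA; congr fcoef; apply: eq_bigr => v _.
rewrite /G scaler_prod big_split /= prodrXr.
by congr (_ * _ *: _ ^+ _); apply: eq_bigr => j _; rewrite !ffunE.
Qed.

(** * The generating sets as limits of words, and the three equalities *)

Definition zeta_letters (C : nat -> {poly rat} -> Prop) : set letter :=
  [set f | exists s Q, C s Q /\ f = zeta_letter s Q].

Definition bi_letters (C : nat -> nat -> Prop) : set letter :=
  [set f | exists s r, C s r /\ f = bi_letter s r].

Lemma qzeta_headed_sums (C0 C : nat -> {poly rat} -> Prop) :
  (forall s Q, C0 s Q -> tQt Q) ->
  [set f | exists l (s : 'I_l -> nat) (Q : 'I_l -> {poly rat}),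
     (forall j : 'I_l,
        if j == 0%N :> nat then C0 (s j) (Q j) else C (s j) (Q j)) /\
     f = qzeta s Q] =
  sum_lim @` headed_sums (zeta_letters C0) (zeta_letters C).
Proof.
move=> C0Q; apply/seteqP; split=> [f [l [s [Q [CsQ ->]]]]|].
  rewrite qzetaE => [|j j0]; last first.
    by have := CsQ j; rewrite j0 eqxx => /C0Q.
  eexists; last reflexivity; apply/headed_sumsP; exists l; eexists.
  split; [|reflexivity] => j; have := CsQ j.
  by case: ifP => _ ?; exists (s j), (Q j).
move=> _ [F /headed_sumsP[l [f [Hf ->]]] <-].
have /choice[sQ sQP] (j : 'I_l) : exists sQ : nat * {poly rat},
    (if j == 0%N :> nat then C0 sQ.1 sQ.2 else C sQ.1 sQ.2) /\
    f j = zeta_letter sQ.1 sQ.2.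
  by have := Hf j; case: ifP => _ [s [Q [CsQ fE]]]; exists (s, Q).
exists l, (fun j => (sQ j).1), (fun j => (sQ j).2); split.
  by move=> j; case: (sQP j).
rewrite qzetaE => [|j j0]; last first.
  by have [] := sQP j; rewrite j0 eqxx => /C0Q.
by congr (sum_lim (word_sum _)); apply/funext => j; case: (sQP j).
Qed.

Lemma qzeta_word_sums (C : nat -> {poly rat} -> Prop) :
  (forall s Q, C s Q -> tQt Q) ->
  [set f | exists l (s : 'I_l -> nat) (Q : 'I_l -> {poly rat}),
     (forall j, C (s j) (Q j)) /\ f = qzeta s Q] =
  sum_lim @` word_sums (zeta_letters C).
Proof.
move=> CQ; rewrite -headed_sums_diag -qzeta_headed_sums //.
apply/seteqP; split=> f [l [s [Q [CsQ ->]]]]; exists l, s, Q; split=> // j.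
  by case: ifP.
by have := CsQ j; case: ifP.
Qed.

Lemma bibracket_word_sums (C : nat -> nat -> Prop) :
  [set f | exists l (s r : 'I_l -> nat),
     (forall j, C (s j) (r j)) /\ f = bibracket s r] =
  sum_lim @` word_sums (bi_letters C).
Proof.
apply/seteqP; split=> [f [l [s [r [Csr ->]]]]|].
  rewrite bibracketE; eexists; last reflexivity.
  apply/word_sumsP; exists l; eexists; split; last reflexivity.
  by move=> j; exists (s j), (r j).
move=> _ [F /word_sumsP[l [f [Gf ->]]] <-].
have /choice[sr srP] j : exists sr : nat * nat,
    C sr.1 sr.2 /\ f j = bi_letter sr.1 sr.2.
  by have [s [r [Csr fE]]] := Gf j; exists (s, r).
exists l, (fun j => (sr j).1), (fun j => (sr j).2); split.
  by move=> j; case: (srP j).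
rewrite bibracketE; congr (sum_lim (word_sum _)).
by apply/funext => j; case: (srP j).
Qed.

Lemma bracket_word_sums a :
  [set f | exists l (s : 'I_l -> nat),
     (forall j, a <= s j)%N /\ f = bracket s] =
  sum_lim @` word_sums (bi_letters (fun s r => (a <= s)%N /\ r = 0%N)).
Proof.
rewrite -bibracket_word_sums; apply/seteqP; split=> f.
  by move=> [l [s [sa ->]]]; exists l, s, (fun=> 0%N).
move=> [l [s [r [sr ->]]]]; exists l, s; split; first by move=> j; case: (sr j).
by congr bibracket; apply/funext => j; case: (sr j).
Qed.

Lemma word_sums_span_eq (G G' : set letter) : G `<=` lin_span G' ->
  G' `<=` lin_span G -> lin_span (word_sums G) = lin_span (word_sums G').
Proof. by move=> ? ?; apply: lin_span_eq; apply: word_sums_span. Qed.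

Lemma headed_sums_span_eq (H G H' G' : set letter) :
  H `<=` lin_span H' -> H' `<=` lin_span H ->
  G `<=` lin_span G' -> G' `<=` lin_span G ->
  lin_span (headed_sums H G) = lin_span (headed_sums H' G').
Proof. by move=> *; apply: lin_span_eq; apply: headed_sums_span. Qed.

Lemma lin_span_mono (V : lmodType rat) (S S' : set V) :
  S `<=` S' -> lin_span S `<=` lin_span S'.
Proof. by move=> SS'; apply: lin_span_sub => f /SS'; apply: mem_lin_span. Qed.

Lemma zeta_letters_poles : zeta_letters
    (fun s Q => [/\ (1 <= s)%N, tQt Q & (size Q <= s.+1)%N]) `<=`
  lin_span poles.
Proof.
move=> _ [s [Q [[_ QX Qs] ->]]].
apply: lin_span_mono (zeta_letter_poles QX Qs (leqnn s)).
by move=> _ [k _ <-]; exists k.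
Qed.

Lemma poles_zeta_letters : poles `<=` zeta_letters
    (fun s Q => [/\ (1 <= s)%N, tQt Q & (size Q <= s.+1)%N]).
Proof.
move=> _ [j _ <-]; exists j.+1, 'X; split; last exact: pole_zeta_letter.
by rewrite /tQt /mkset dvdpp size_polyX.
Qed.

Lemma Zq_poles : Zq = lin_span (sum_lim @` headed_sums poles unit_poles).
Proof.
pose C0 s (Q : {poly rat}) := [/\ (1 <= s)%N, tQt Q & (size Q <= s.+1)%N].
pose C s (Q : {poly rat}) := (1 <= s)%N /\ (size Q <= s.+1)%N.
transitivity (lin_span
    (sum_lim @` headed_sums (zeta_letters C0) (zeta_letters C))).
  rewrite -qzeta_headed_sums => [|s Q []//]; congr lin_span.
  apply/seteqP; split=> f [l [s [Q]]].
    move=> [s1 Q0 Qs ->]; exists l, s, Q; split=> // j.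
    by case: eqP => [j0|_]; split=> //; apply: Q0.
  move=> [CsQ ->]; exists l, s, Q; split=> // j; have := CsQ j.
  - by case: ifP => _ [].
  - by move=> + j0; rewrite j0 eqxx => -[].
  - by case: ifP => _ [].
apply/lin_span_sum_lim/headed_sums_span_eq.
- exact: zeta_letters_poles.
- by move=> f /poles_zeta_letters; apply: mem_lin_span.
- by move=> _ [s [Q [[_ Qs] ->]]]; apply: zeta_letter_unit_poles.
(* The letter 1 is (1 - t) / (1 - t), with s = 1 and deg Q = 1; it is allowed after the first
   position. *)
move=> f [->|/poles_zeta_letters[s [Q [[s1 _ Qs] ->]]]]; apply: mem_lin_span.
  exists 1%N, (1 - 'X); split; last exact: unit_zeta_letter.
  by split=> //; rewrite -[1 - 'X]expr1 size_subX1_exp.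
by exists s, Q.
Qed.

Lemma Zq_circ_poles : Zq_circ = lin_span (sum_lim @` word_sums poles).
Proof.
transitivity (lin_span (sum_lim @` word_sums (zeta_letters
    (fun s Q => [/\ (1 <= s)%N, tQt Q & (size Q <= s.+1)%N])))).
  rewrite -qzeta_word_sums => [|s Q []//]; congr lin_span.
  apply/seteqP; split=> f [l [s [Q]]].
    by move=> [s1 Q0 Qs ->]; exists l, s, Q; split.
  by move=> [CsQ ->]; exists l, s, Q; split=> // j; case: (CsQ j).
apply/lin_span_sum_lim/word_sums_span_eq; first exact: zeta_letters_poles.
by move=> f /poles_zeta_letters; apply: mem_lin_span.
Qed.

Lemma Zq_circ1_poles : Zq_circ1 =
  lin_span (sum_lim @` word_sums (pole_letter @` [set k | (1 <= k)%N])).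
Proof.
pose C s (Q : {poly rat}) := [/\ (1 <= s)%N, tQt Q & (size Q <= s.-1.+1)%N].
transitivity (lin_span (sum_lim @` word_sums (zeta_letters C))).
  rewrite -qzeta_word_sums => [|s Q []//]; congr lin_span.
  apply/seteqP; split=> f [l [s [Q]]].
    by move=> [s1 Q0 Qs ->]; exists l, s, Q; split.
  by move=> [CsQ ->]; exists l, s, Q; split=> // j; case: (CsQ j).
apply/lin_span_sum_lim/word_sums_span_eq.
  move=> _ [s [Q [[s1 QX Qs] ->]]].
  apply: lin_span_mono (zeta_letter_poles QX Qs (leq_pred s)) => _ [k /= sk <-].
  by exists k => //; apply: leq_trans sk; rewrite subn_gt0 prednK.
(* The pole of index j + 1 is t / (1 - t)^(j+2), and deg t = 1 <= s - 1 as s = j + 2. *)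
move=> _ [[|j] // _ <-]; apply: mem_lin_span; exists j.+2, 'X.
split; last exact: pole_zeta_letter.
by rewrite /C /tQt /mkset dvdpp size_polyX.
Qed.

Theorem mainTheorem1 :
  [/\ Zq = lin_span [set f : fps | exists (l : nat) (s r : 'I_l -> nat),
             (forall j, (1 <= s j)%N) /\ f = bibracket s r],
      Zq_circ = lin_span [set f : fps | exists (l : nat) (s : 'I_l -> nat),
             (forall j, (1 <= s j)%N) /\ f = bracket s]
    & Zq_circ1 = lin_span [set f : fps | exists (l : nat) (s : 'I_l -> nat),
             (forall j, (2 <= s j)%N) /\ f = bracket s]].
Proof.
split.
- rewrite Zq_poles (bibracket_word_sums (fun s _ => (1 <= s)%N)).
  apply: lin_span_sum_lim; rewrite headed_unit_poles_span.
  apply: word_sums_span_eq => f; first exact: poly_poles_bi_letter.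
  by move=> [s [r [_ ->]]]; apply: bi_letter_poly_poles.
- rewrite Zq_circ_poles bracket_word_sums.
  apply/lin_span_sum_lim/word_sums_span_eq =>
    [_ [j _ <-]|_ [s [_ [[_ ->] ->]]]].
    apply: lin_span_mono (pole_bi_letter0 j) => f [s [s1 ->]].
    by exists s, 0%N.
  exact: bi_letter0_poles.
- rewrite Zq_circ1_poles bracket_word_sums.
  apply/lin_span_sum_lim/word_sums_span_eq =>
    [_ [j j1 <-]|_ [s [_ [[s2 ->] ->]]]].
    apply: lin_span_mono (pole_bi_letter0_1 j1) => f [s [s2 ->]].
    by exists s, 0%N.
  exact: bi_letter0_poles1.
Qed.
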